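(* Let $x_n(s):\Sigma\times I\to\mathbb{R}^2\cong\mathbb{C}$ be an isoperimetric mKdV motion of discrete curves. Then the tangential angles $\theta_n(s)$ of the smooth curves $s\mapsto x_n(s)$ satisfy, for every edge $(n,n+1)$ of $\Sigma$, the semi-discrete potential mKdV equation $$\left(\frac{\theta_{n+1}+\theta_n}{2}\right)'=\frac{2}{a_n}\sin\left(\frac{\theta_{n+1}-\theta_n}{2}\right).$$
   Context: Identify $\mathbb{R}^2\cong\mathbb{C}$; $'$ denotes $\frac{d}{ds}$; $I\subset\mathbb{R}$ is an interval; $\Sigma\subset\mathbb{Z}$ is a discrete interval (a set of consecutive integers), with edges $(n,n+1)$, $n,n+1\in\Sigma$. A discrete curve $n\mapsto x_n\in\mathbb{R}^2$ is regular if $\det(x_n-x_{n-1}\;\;x_{n+1}-x_n)\ne0$ on any three consecutive vertices. Isoperimetric mKdV motion: a map $x:\Sigma\times I\to\mathbb{C}$, smooth in $s$, with $x_n\neq x_{n+1}$ on every edge, with every discrete curve $x(s)$ regular, with $|x_n'|\equiv1$ for all $(n,s)$, and satisfying the following isoperimetric condition. Put $a_n=|x_{n+1}-x_n|$ and $T_n=(x_{n+1}-x_n)/a_n=e^{i\psi_n}$ with $\psi_n$ a smooth argument of $T_n$. Let $w_n$ be the angle from $T_n$ to $x_n'$, i.e. $x_n'=e^{iw_n}T_n$, and let $\kappa_{n+1}$ (discrete curvature) be given by $\psi_{n+1}=\psi_n+\kappa_{n+1}$, so that $w_{n+1}+\kappa_{n+1}$ is the angle from $T_n$ to $x_{n+1}'$.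 The condition, on every edge, is $w_{n+1}+\kappa_{n+1}=-w_n$, i.e. $x_{n+1}'=e^{-iw_n}T_n$ (in this last form it also makes sense when $n+1$ is the last vertex). It is the condition for the motion to be isoperimetric ($a_n'\equiv0$), the trivial solution $w_{n+1}+\kappa_{n+1}=w_n$ being excluded. Tangential angle: $\theta_n$ is a smooth real-valued argument of $x_n'$, i.e. $x_n'=e^{i\theta_n}$, so that $\theta_n=\psi_n+w_n$. Branches of the angles are chosen so that the relations $\theta_n=\psi_n+w_n$, $\psi_{n+1}=\psi_n+\kappa_{n+1}$ and $w_{n+1}+\kappa_{n+1}=-w_n$ hold exactly as real numbers; in particular, $\theta_{n+1}=\psi_n-w_n$ on every edge. *)

(* Defs.v *)
From Stdlib Require Import Reals ZArith.
From Coquelicot Require Import Coquelicot.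
Open Scope R_scope.

(** The condition [a < b] excludes one-point intervals, on which there is no
    notion of derivative; the interval may contain either of its endpoints,
    both or none, and may be unbounded. *)
Definition is_interval (I : R -> Prop) : Prop :=
  (exists a b : R, a < b /\ I a /\ I b) /\
  (forall a b c : R, I a -> I b -> a <= c <= b -> I c).

Definition is_discrete_interval (Sigma : Z -> Prop) : Prop :=
  forall m n k : Z, Sigma m -> Sigma n -> (m <= k <= n)%Z -> Sigma k.

Definition is_edge (Sigma : Z -> Prop) (n : Z) : Prop :=
  Sigma n /\ Sigma (n + 1)%Z.

(** This is [is_derive] with [locally s] replaced by its trace on [I]: it is the
    ordinary derivative at interior points of [I], the one-sided derivative at
    an endpoint belonging to [I], and ignores the values of [f] outside [I]. *)
Definition is_derive_on {V : NormedModule R_AbsRing}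
    (I : R -> Prop) (f : R -> V) (s : R) (l : V) : Prop :=
  filterdiff f (within I (locally s)) (fun h : R => scal h l).

(** [D k] is the [k]-th derivative of [f] on [I]. *)
Definition smooth_on {V : NormedModule R_AbsRing}
    (I : R -> Prop) (f : R -> V) : Prop :=
  exists D : nat -> R -> V,
    (forall s, I s -> D 0%nat s = f s) /\
    (forall k s, I s -> is_derive_on I (D k) s (D (S k) s)).

(** Derivatives of plane curves are taken over the real scalars. *)
Definition is_cderive_on (I : R -> Prop) (f : R -> C) (s : R) (l : C) : Prop :=
  @is_derive_on C_R_NormedModule I f s l.
Definition csmooth_on (I : R -> Prop) (f : R -> C) : Prop :=
  @smooth_on C_R_NormedModule I f.

(** [cis t] is e^(it). *)
Definition cis (t : R) : C := (cos t, sin t).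

Definition cdet (u v : C) : R := Re u * Im v - Im u * Re v.

Definition regular_curve (Sigma : Z -> Prop) (y : Z -> C) : Prop :=
  forall n : Z, Sigma (n - 1)%Z -> Sigma n -> Sigma (n + 1)%Z ->
    cdet (y n - y (n - 1)%Z)%C (y (n + 1)%Z - y n)%C <> 0.

Definition edge_length (x : Z -> R -> C) (n : Z) (s : R) : R :=
  Cmod (x (n + 1)%Z s - x n s)%C.

Definition edge_tangent (x : Z -> R -> C) (n : Z) (s : R) : C :=
  ((x (n + 1)%Z s - x n s) / RtoC (edge_length x n s))%C.

(** [x] is only relevant on [Sigma] and [I], outside of which its values are
    junk; [dx] is the velocity x'.  In [mkdv_isoperimetric] the choice of the
    angle [w] is immaterial, since it is determined modulo 2 pi. *)
Record isoperimetric_mkdv_motion (Sigma : Z -> Prop) (I : R -> Prop)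
    (x dx : Z -> R -> C) : Prop := {
  mkdv_smooth : forall n, Sigma n -> csmooth_on I (x n);
  mkdv_velocity : forall n s, Sigma n -> I s ->
    is_cderive_on I (x n) s (dx n s);
  mkdv_distinct : forall n s, is_edge Sigma n -> I s ->
    x n s <> x (n + 1)%Z s;
  mkdv_regular : forall s, I s -> regular_curve Sigma (fun n => x n s);
  mkdv_unit_speed : forall n s, Sigma n -> I s -> Cmod (dx n s) = 1;
  mkdv_isoperimetric : forall n s, is_edge Sigma n -> I s ->
    exists w : R,
      dx n s = (cis w * edge_tangent x n s)%C /\
      dx (n + 1)%Z s = (cis (- w) * edge_tangent x n s)%C
}.

(** A choice of branches of all the angles.  [psi n] and [w n] belong to the
    edge (n, n+1), [theta n] and [kappa n] to the vertex n.  When n+1 is the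
    last vertex, [w (n + 1)] and [kappa (n + 1)] do not exist, and
    [angles_next] is what normalizes the branch of [theta (n + 1)]. *)
Record angle_branches (Sigma : Z -> Prop) (I : R -> Prop)
    (x dx : Z -> R -> C) (psi w kappa theta : Z -> R -> R) : Prop := {
  angles_psi_smooth : forall n, is_edge Sigma n -> smooth_on I (psi n);
  angles_psi : forall n s, is_edge Sigma n -> I s ->
    edge_tangent x n s = cis (psi n s);
  angles_w : forall n s, is_edge Sigma n -> I s ->
    dx n s = (cis (w n s) * edge_tangent x n s)%C;
  angles_theta_smooth : forall n, Sigma n -> smooth_on I (theta n);
  angles_theta : forall n s, Sigma n -> I s -> dx n s = cis (theta n s);
  angles_theta_psi_w : forall n s, is_edge Sigma n -> I s ->
    theta n s = psi n s + w n s;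
  angles_kappa : forall n s, is_edge Sigma n -> is_edge Sigma (n + 1)%Z -> I s ->
    psi (n + 1)%Z s = psi n s + kappa (n + 1)%Z s;
  angles_isoperimetric : forall n s,
    is_edge Sigma n -> is_edge Sigma (n + 1)%Z -> I s ->
    w (n + 1)%Z s + kappa (n + 1)%Z s = - w n s;
  angles_next : forall n s, is_edge Sigma n -> I s ->
    theta (n + 1)%Z s = psi n s - w n s
}.

(* Main.v *)
Require Import Defs.
From Stdlib Require Import Reals ZArith Lra.
From Coquelicot Require Import Coquelicot.
Open Scope R_scope.

(** On the edge (n, n+1) the branches give theta_n = psi_n + w_n and
    theta_(n+1) = psi_n - w_n, so the mean of the two tangential angles is the
    angle psi_n of the edge and half their difference is - w_n.  The claim is
    therefore that the edge turns at the rate - 2 sin(w_n) / a_n.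

    The edge vector is a_n e^(i psi_n), and its velocity
    x_(n+1)' - x_n' = (e^(-i w_n) - e^(i w_n)) e^(i psi_n)
    = - 2 i sin(w_n) e^(i psi_n) is normal to the edge.  For a vector
    r e^(i psi), the component of the velocity normal to the vector is r psi'
    ([angular_velocity]); comparing the two gives a_n psi_n' = - 2 sin(w_n).

    [angular_velocity] is obtained by differentiating the relation
    det(e^(i psi), r e^(i psi)) = 0, in which r does not appear once the vector
    is written in coordinates, so that no differentiability of the length is
    required.  The rules of calculus are needed for derivatives relative to an
    interval; they follow from those for differentials along a filter, and a
    derivative relative to an interval is unique because no point of a
    nondegenerate interval is isolated in it ([is_derive_on_zero]). *)

(** * Derivatives relative to a set *)

Lemma within_locally_proper (I : R -> Prop) (s : R) :
  I s -> ProperFilter (within I (locally s)).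
Proof.
  intros Is; split.
  - intros P HP. exists s. exact (locally_singleton _ _ HP Is).
  - apply within_filter, locally_filter.
Qed.

Lemma within_locally_lim (I : R -> Prop) (s : R) :
  is_filter_lim (within I (locally s)) s.
Proof.
  intros P HP. apply filter_le_within. exact HP.
Qed.

Lemma within_locally_lim_unique (I : R -> Prop) (s x : R) :
  I s -> is_filter_lim (within I (locally s)) x -> s = x.
Proof.
  intros Is Hx.
  pose proof (within_locally_proper I s Is) as PF.
  exact (is_filter_lim_unique (K := R_AbsRing) (V := R_NormedModule)
           s x (within_locally_lim I s) Hx).
Qed.

Section Calculus.

Variables (I : R -> Prop) (s : R).
Hypothesis Is : I s.

Let proper : ProperFilter (within I (locally s)) := within_locally_proper I s Is.
#[local] Existing Instance proper.

Lemma is_derive_on_ext {V : NormedModule R_AbsRing} (f g : R -> V) (l : V) :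
  (forall t, I t -> f t = g t) -> is_derive_on I f s l -> is_derive_on I g s l.
Proof.
  intros Hfg. unfold is_derive_on. apply filterdiff_ext_loc.
  - apply (filter_forall (F := locally s)). exact Hfg.
  - intros x Hx. rewrite <- (within_locally_lim_unique I s x Is Hx).
    exact (Hfg s Is).
Qed.

Lemma is_derive_on_lim {V : NormedModule R_AbsRing} (f : R -> V) (l : V) :
  is_derive_on I f s l ->
  is_filter_lim (filtermap f (within I (locally s))) (f s).
Proof.
  intros Hf.
  apply (filterdiff_continuous_aux (U := R_NormedModule) f).
  - eexists; exact Hf.
  - apply within_locally_lim.
Qed.

Lemma is_derive_on_comp (f g : R -> R) (l m : R) :
  is_derive_on I f s l -> is_derive g (f s) m ->
  is_derive_on I (fun t => g (f t)) s (m * l).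
Proof.
  intros Hf Hg. unfold is_derive_on.
  eapply filterdiff_ext_lin.
  - apply filterdiff_comp with (1 := Hf).
    apply (filterdiff_locally g (f s)).
    + exact (is_derive_on_lim f l Hf).
    + exact Hg.
  - intros h. unfold scal; simpl; unfold mult; simpl. ring.
Qed.

Lemma is_derive_on_minus {V : NormedModule R_AbsRing} (f g : R -> V) (l m : V) :
  is_derive_on I f s l -> is_derive_on I g s m ->
  is_derive_on I (fun t => minus (f t) (g t)) s (minus l m).
Proof.
  intros Hf Hg. unfold is_derive_on.
  eapply filterdiff_ext_lin.
  - exact (filterdiff_minus_fct _ _ _ _ Hf Hg).
  - intros h. simpl. symmetry. exact (scal_minus_distr_l h l m).
Qed.

Lemma is_derive_on_mult (f g : R -> R) (l m : R) :
  is_derive_on I f s l -> is_derive_on I g s m ->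
  is_derive_on I (fun t => f t * g t) s (l * g s + f s * m).
Proof.
  intros Hf Hg. unfold is_derive_on.
  eapply filterdiff_ext_lin.
  - apply (filterdiff_comp_2 (V := R_NormedModule) (W := R_NormedModule)
             f g Rmult _ _ (fun u v => plus (mult u (g s)) (mult (f s) v)) Hf Hg).
    apply (filterdiff_mult (K := R_AbsRing) (f s, g s)).
    + intros P [e He].
      assert (Pf := is_derive_on_lim f l Hf _ (locally_ball (f s) e)).
      assert (Pg := is_derive_on_lim g m Hg _ (locally_ball (g s) e)).
      unfold filtermap in *.
      generalize (filter_and _ _ Pf Pg). apply filter_imp.
      intros t [H1 H2]. apply He. split; assumption.
    + exact Rmult_comm.
  - intros h. unfold scal, plus; simpl; unfold mult; simpl. ring.
Qed.

Lemma is_derive_on_linear {V W : NormedModule R_AbsRing} (L : V -> W)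
    (f : R -> V) (l : V) :
  is_linear L -> is_derive_on I f s l ->
  is_derive_on I (fun t => L (f t)) s (L l).
Proof.
  intros HL Hf. unfold is_derive_on.
  eapply filterdiff_ext_lin.
  - apply filterdiff_comp with (1 := Hf). apply filterdiff_linear, HL.
  - intros h. exact (linear_scal L HL h l).
Qed.

(** The interval contains a point c distinct from s, hence points
    s + t (c - s) arbitrarily close to s, at which the remainder of a function
    vanishing on I is |l| |y - s|. *)
Lemma is_derive_on_zero (f : R -> R) (l : R) :
  is_interval I -> (forall t, I t -> f t = 0) -> is_derive_on I f s l -> l = 0.
Proof.
  intros [[a [b [Hab [Ia Ib]]]] conv] Hf [_ Hd].
  destruct (Req_dec l 0) as [|Hl]; [assumption | exfalso].
  assert (Hc : exists c, I c /\ c <> s).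
  { destruct (Req_dec a s) as [E|]; [exists b | exists a]; split; auto; lra. }
  destruct Hc as [c [Ic Hcs]].
  assert (Hl2 : 0 < Rabs l / 2) by (pose proof (Rabs_pos_lt l Hl); lra).
  destruct (Hd s (within_locally_lim I s) (mkposreal _ Hl2)) as [e He].
  simpl in He.
  set (d := Rabs (c - s)).
  assert (Hdpos : 0 < d) by (apply Rabs_pos_lt; lra).
  set (t := Rmin 1 (e / (2 * d))).
  assert (He0 := cond_pos e).
  assert (Hq : 0 < e / (2 * d)) by (apply Rdiv_lt_0_compat; lra).
  assert (Ht0 : 0 < t) by (apply Rmin_glb_lt; lra).
  assert (Ht1 : t <= 1) by apply Rmin_l.
  assert (Ht2 : t * d < e).
  { apply Rle_lt_trans with (e / (2 * d) * d).
    - apply Rmult_le_compat_r; [lra | apply Rmin_r].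
    - replace (e / (2 * d) * d) with (e / 2) by (field; lra). lra. }
  set (y := s + t * (c - s)).
  assert (Hys : Rabs (y - s) = t * d).
  { replace (y - s) with (t * (c - s)) by (unfold y; ring).
    rewrite Rabs_mult, (Rabs_pos_eq t) by lra. reflexivity. }
  assert (Iy : I y).
  { unfold y. destruct (Rle_dec s c).
    - apply (conv s c); auto. split; nra.
    - apply (conv c s); auto. split; nra. }
  assert (Hb : ball s e y).
  { unfold ball; simpl; unfold AbsRing_ball, abs, minus, plus, opp; simpl.
    fold (y - s). rewrite Hys. exact Ht2. }
  specialize (He y Hb Iy).
  unfold norm, minus, plus, opp, scal in He; simpl in He.
  unfold abs, mult in He; simpl in He.
  rewrite (Hf y Iy), (Hf s Is) in He.
  replace (0 + - 0 + - ((y + - s) * l)) with (- ((y - s) * l)) in He by ring.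
  rewrite Rabs_Ropp, Rabs_mult in He. fold (y - s) in He. rewrite Hys in He.
  pose proof (Rmult_lt_0_compat t d Ht0 Hdpos). nra.
Qed.

(** * Rotation of a plane vector *)

(** A vector r e^(i psi) remains parallel to e^(i psi), so the determinant of the
    two is constantly zero.  In its derivative the term coming from the rotation
    of e^(i psi) is - r psi', the one coming from the vector is the left side. *)
Lemma angular_velocity (d : R -> C) (r psi : R -> R) (D : C) (p : R) :
  is_interval I ->
  (forall t, I t -> d t = (RtoC (r t) * cis (psi t))%C) ->
  is_cderive_on I d s D -> is_derive_on I psi s p ->
  cdet (cis (psi s)) D = r s * p.
Proof.
  intros HI Hd HD Hp.
  assert (H1 : is_derive_on I (fun t => Re (d t)) s (Re D)).
  { apply (is_derive_on_linear (V := C_R_NormedModule) Re d D); auto.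
    exact (is_linear_fst (U := R_NormedModule) (V := R_NormedModule)). }
  assert (H2 : is_derive_on I (fun t => Im (d t)) s (Im D)).
  { apply (is_derive_on_linear (V := C_R_NormedModule) Im d D); auto.
    exact (is_linear_snd (U := R_NormedModule) (V := R_NormedModule)). }
  assert (Hcos := is_derive_on_comp psi cos p _ Hp (is_derive_cos (psi s))).
  assert (Hsin := is_derive_on_comp psi sin p _ Hp (is_derive_sin (psi s))).
  assert (Hdet := is_derive_on_minus _ _ _ _
    (is_derive_on_mult _ _ _ _ Hcos H2) (is_derive_on_mult _ _ _ _ Hsin H1)).
  apply is_derive_on_zero in Hdet; trivial.
  - rewrite (Hd s Is) in Hdet.
    unfold minus, plus, opp in Hdet; simpl in Hdet. unfold cdet; simpl.
    pose proof (sin2_cos2 (psi s)) as E; unfold Rsqr in E.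
    replace (r s * p) with (r s * p * (sin (psi s) * sin (psi s)
      + cos (psi s) * cos (psi s))) by (rewrite E; ring).
    lra.
  - intros t It. rewrite (Hd t It).
    unfold minus, plus, opp; simpl. ring.
Qed.

End Calculus.

(** * Rotation of the edges *)

(** The two endpoint velocities e^(iw) T and e^(-iw) T are mirror images in the
    line of the edge, so their difference is normal to it. *)
Lemma cdet_reflected_velocities (psi w : R) :
  cdet (cis psi) (cis (- w) * cis psi - cis w * cis psi)%C = - 2 * sin w.
Proof.
  unfold cdet; simpl. rewrite sin_neg, cos_neg.
  pose proof (sin2_cos2 psi) as E; unfold Rsqr in E.
  replace (- 2 * sin w) with (- 2 * sin w * (sin psi * sin psi
    + cos psi * cos psi)) by (rewrite E; ring).
  ring.
Qed.

Lemma edge_length_pos (Sigma : Z -> Prop) (I : R -> Prop) (x dx : Z -> R -> C)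
    (n : Z) (s : R) :
  isoperimetric_mkdv_motion Sigma I x dx -> is_edge Sigma n -> I s ->
  0 < edge_length x n s.
Proof.
  intros hx En Is. apply Cmod_gt_0. intros E.
  apply (mkdv_distinct _ _ _ _ hx n s En Is).
  symmetry. replace (x (n + 1)%Z s) with (x (n + 1)%Z s - x n s + x n s)%C by ring.
  rewrite E. ring.
Qed.

Theorem theorem3p2 (Sigma : Z -> Prop) (I : R -> Prop)
    (x dx : Z -> R -> C) (psi w kappa theta : Z -> R -> R)
    (hSigma : is_discrete_interval Sigma) (hI : is_interval I)
    (hx : isoperimetric_mkdv_motion Sigma I x dx)
    (hangles : angle_branches Sigma I x dx psi w kappa theta) :
  forall (n : Z) (s : R), is_edge Sigma n -> I s ->
    is_derive_on I (fun t : R => (theta (n + 1)%Z t + theta n t) / 2) s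
      (2 / edge_length x n s * sin ((theta (n + 1)%Z s - theta n s) / 2)).
Proof.
  intros n s En Is.
  apply (is_derive_on_ext I s Is (psi n)).
  { intros t It. change (psi n t = (theta (n + 1)%Z t + theta n t) / 2).
    rewrite (angles_next _ _ _ _ _ _ _ _ hangles n t En It),
      (angles_theta_psi_w _ _ _ _ _ _ _ _ hangles n t En It). field. }
  destruct (angles_psi_smooth _ _ _ _ _ _ _ _ hangles n En) as [Dk [D0 DS]].
  assert (Hp : is_derive_on I (psi n) s (Dk 1%nat s)).
  { apply (is_derive_on_ext I s Is (Dk 0%nat)); [exact D0 | exact (DS 0%nat s Is)]. }
  assert (Hlen : forall t, I t -> 0 < edge_length x n t)
    by (intros t It; exact (edge_length_pos Sigma I x dx n t hx En It)).
  assert (Hv : is_cderive_on I (fun t => x (n + 1)%Z t - x n t)%C s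
                 (dx (n + 1)%Z s - dx n s)%C).
  { destruct En as [E1 E2].
    exact (is_derive_on_minus (V := C_R_NormedModule) I s _ _ _ _
      (mkdv_velocity _ _ _ _ hx _ s E2 Is) (mkdv_velocity _ _ _ _ hx _ s E1 Is)). }
  assert (Hpolar : forall t, I t ->
    (x (n + 1)%Z t - x n t)%C = (RtoC (edge_length x n t) * cis (psi n t))%C).
  { intros t It. rewrite <- (angles_psi _ _ _ _ _ _ _ _ hangles n t En It).
    unfold edge_tangent. field.
    intros E. apply RtoC_inj in E. specialize (Hlen t It). lra. }
  assert (Hrot := angular_velocity I s Is _ _ _ _ _ hI Hpolar Hv Hp).
  assert (Hth := angles_theta_psi_w _ _ _ _ _ _ _ _ hangles n s En Is).
  assert (Hnx := angles_next _ _ _ _ _ _ _ _ hangles n s En Is).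
  assert (Hdx : dx n s = (cis (w n s) * cis (psi n s))%C).
  { rewrite (angles_w _ _ _ _ _ _ _ _ hangles n s En Is),
      (angles_psi _ _ _ _ _ _ _ _ hangles n s En Is). reflexivity. }
  assert (Hdx1 : dx (n + 1)%Z s = (cis (- w n s) * cis (psi n s))%C).
  { rewrite (angles_theta _ _ _ _ _ _ _ _ hangles (n + 1)%Z s (proj2 En) Is), Hnx.
    unfold Rminus, cis, Cmult; simpl. rewrite cos_plus, sin_plus. f_equal; ring. }
  rewrite Hdx, Hdx1, cdet_reflected_velocities in Hrot.
  replace (2 / edge_length x n s * sin ((theta (n + 1)%Z s - theta n s) / 2))
    with (Dk 1%nat s); [exact Hp |].
  replace ((theta (n + 1)%Z s - theta n s) / 2) with (- w n s)
    by (rewrite Hth, Hnx; field).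
  rewrite sin_neg. specialize (Hlen s Is).
  apply (Rmult_eq_reg_l (edge_length x n s)); [| lra].
  rewrite <- Hrot. field. lra.
Qed.
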